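(* Consider the mixed Hegselmann-Krause model on $\mathbb{Z}^+$ under group interaction, with opinions in $\mathbb{R}^d$. Assume that the social graph $G=(\mathbb{Z}^+,E)$ is $(r-1)$-regular for some integer $r\geq1$, that $\alpha_i(t)=\alpha_t$ for all $i\geq1$ and $t\geq0$ with $\liminf_{t\to\infty}\alpha_t<1$, and that $3|N_i^s\cap N_j^s|>2r$ for all edges $(i,j)\in E$. If the profile $G\cap\mathscr{G}(s)$ is $G$ for some time $s\geq0$, then $$\sup_{(i,j)\in E}\|x_i(t)-x_j(t)\|\to0\quad\text{as } t\to\infty.$$
   Context: Mixed Hegselmann-Krause model on an infinite graph, group interaction. Individuals are the vertices $\mathbb{Z}^+=\{1,2,\dots\}$. The social graph $G=(\mathbb{Z}^+,E)$ is a fixed undirected simple graph in which every vertex has finite degree. $N_i^s=\{j\geq1: j=i\ \text{or}\ (i,j)\in E\}$ is the set of all social neighbors of $i$ including $i$ itself (the superscript $s$ in $N_i^s$ is only a label standing for ''social'' and is unrelated to the time $s$). Time is discrete, $t=0,1,2,\dots$, and $x_i(t)\in\mathbb{R}^d$ is the opinion of individual $i$ at time $t$; $\|\cdot\|$ is the Euclidean norm and $\epsilon>0$ is a fixed confidence threshold. The opinion graph at time $t$ is $\mathscr{G}(t)=(\mathbb{Z}^+,\mathscr{E}(t))$ with $\mathscr{E}(t)=\{(i,j): i\neq j,\ \|x_i(t)-x_j(t)\|\leq\epsilon\}$. Under group interaction the profile at time $t$ is $G\cap\mathscr{G}(t)=(\mathbb{Z}^+,E\cap\mathscr{E}(t))$.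 The degree of stubbornness of $i$ at time $t$ is $\alpha_i(t)\in[0,1]$; for each $i$, the $\alpha_i(t)$, $t\ge0$, are independent and identically distributed random variables on $[0,1]$. The sets $U_t=\{i\geq1:\alpha_i(t)<1\}$, $t\ge 0$, are independent and identically distributed with support $S\subset\mathscr{P}(\mathbb{Z}^+)$ (the power set of $\mathbb{Z}^+$), and every $i\in\mathbb{Z}^+$ belongs to some $a\in S$. Opinions evolve by $$x_i(t+1)=\alpha_i(t)x_i(t)+\frac{1-\alpha_i(t)}{|\mathscr{N}_i(t)|}\sum_{k\in\mathscr{N}_i(t)}x_k(t),\qquad \mathscr{N}_i(t)=\{j\geq1: j=i\ \text{or}\ (i,j)\in E\cap\mathscr{E}(t)\}.$$ If $E=\emptyset$ (the case $r=1$), the supremum over $E$ is read as $0$. *)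

(* Defs.v *)
From HB Require Import structures.
From mathcomp Require Import all_boot all_order all_algebra finmap.
From mathcomp Require Import all_classical all_reals all_analysis.

Set Implicit Arguments.
Unset Strict Implicit.
Unset Printing Implicit Defensive.

Import Order.TTheory GRing.Theory Num.Theory.
Import numFieldNormedType.Exports.

Local Open Scope classical_set_scope.
Local Open Scope ring_scope.

Notation vertex := {n : nat | (0 < n)%N}.

Section graphs.
Implicit Types E : set (vertex * vertex).

(* An undirected edge {i, j} is represented by both (i, j) and (j, i). *)
Definition simple_graph E : Prop :=
  (forall i, ~ E (i, i)) /\ (forall i j, E (i, j) -> E (j, i)).

Definition locally_finite E : Prop :=
  forall i, finite_set [set j | E (i, j)].

Definition regular_graph E (k : nat) : Prop :=
  forall i, ([set j | E (i, j)] #= `I_k)%card.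

Definition nbhd E (i : vertex) : set vertex := [set j | j = i \/ E (i, j)].

(* Cardinality of a finite set; fset_set is meaningless on infinite sets. *)
Definition ncard (A : set vertex) : nat := #|` fset_set A |.

End graphs.

Section dynamics.
Variables (R : realType) (d : nat).
Implicit Types (E : set (vertex * vertex)) (eps : R) (y : vertex -> 'rV[R]_d).

(* The norm `|v| on 'rV[R]_d is the sup norm, hence this definition. *)
Definition enorm (v : 'rV[R]_d) : R := Num.sqrt (\sum_(k < d) v ord0 k ^+ 2).

Definition opinion_edges eps y : set (vertex * vertex) :=
  [set e | e.1 <> e.2 /\ enorm (y e.1 - y e.2) <= eps].

Definition profile E eps y : set (vertex * vertex) := E `&` opinion_edges eps y.

Definition hk_update E eps (a : vertex -> R) y (i : vertex) : 'rV[R]_d :=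
  let N := nbhd (profile E eps y) i in
  a i *: y i + ((1 - a i) / (ncard N)%:R) *: \sum_(k \in N) y k.

(* The supremum of |y_i - y_j| over the edges, possibly +oo. Adjoining 0 only
   matters when E is empty, where the supremum is 0 by convention. *)
Definition edge_diameter E y : \bar R :=
  ereal_sup (0%E |` [set (enorm (y e.1 - y e.2))%:E | e in E]).

End dynamics.

Section randomness.
Context {disp : measure_display} {T : measurableType disp} {R : realType}.
Variable P : probability T R.

(* Random elements of a type U equipped with a sigma-algebra given as a set of
   subsets G. *)
Definition mutually_independent (U : Type) (G : set (set U))
    (X : nat -> T -> U) : Prop :=
  forall (J : {fset nat}) (B : nat -> set U), (forall t, G (B t)) ->
    P (\bigcap_(t in [set` J]) (X t @^-1` B t)) =
    (\prod_(t <- J) P (X t @^-1` B t))%E.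

Definition identically_distributed (U : Type) (G : set (set U))
    (X : nat -> T -> U) : Prop :=
  forall (t u : nat) (B : set U), G B -> P (X t @^-1` B) = P (X u @^-1` B).

Definition iid (U : Type) (G : set (set U)) (X : nat -> T -> U) : Prop :=
  mutually_independent G X /\ identically_distributed G X.

(* The product sigma-algebra on the power set {0,1}^vertex. *)
Definition powerset_sigma : set (set (set vertex)) :=
  <<s [set [set A : set vertex | A i] | i in [set: vertex]] >>.

(* The topological support, in the Cantor space {0,1}^vertex, of the law of a
   random set X: the basic neighbourhoods of A are the sets of all subsets that
   agree with A on some finite F. *)
Definition random_set_support (X : T -> set vertex) : set (set vertex) :=
  [set A | forall F : {fset vertex},
     (0 < P [set w | forall i, i \in F -> (X w i <-> A i)])%E].

Definition nonstubborn (alpha : vertex -> nat -> T -> R) (t : nat) (w : T) :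
  set vertex := [set i | alpha i t w < 1].

End randomness.

(* Main.v *)
Require Import Defs.
From HB Require Import structures.
From mathcomp Require Import all_boot all_order all_algebra finmap.
From mathcomp Require Import all_classical all_reals all_analysis.
From mathcomp Require Import ring lra zify.
Import Order.TTheory GRing.Theory Num.Theory.
Import numFieldNormedType.Exports.
Local Open Scope classical_set_scope.
Local Open Scope ring_scope.

(** The argument is pathwise and deterministic: fix an outcome and let [b]
    bound the distance across every edge of the social graph. As long as
    [b <= eps], the profile is the whole social graph, so each agent averages
    over its full closed neighbourhood, and all these averages have the same
    number [r] of terms. For an edge (i, j), the contributions of the common
    neighbours cancel in the difference of the two averages; what remains is a
    sum over N_i \ N_j minus a sum over N_j \ N_i. Both sets have
    [n = r - |N_i /\ N_j|] elements, and a vertex of the first is joined to a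
    vertex of the second by the three edges through i and j, so the difference
    of the two sums is at most [3 n b] ([ler_enorm_sum_symdiff]). The overlap
    hypothesis says precisely that [3 n < r], and [3 n <= r - 1] because these
    are integers.

    Hence one step with common stubbornness [a] multiplies the bound by at
    most [a + (1 - a) (r - 1) / r = 1 - (1 - a) / r]
    ([hk_update_edges_within]). This factor never exceeds 1, so the profile
    remains the whole social graph for ever, and the bound keeps shrinking.
    Since the lower limit of the stubbornness is less than 1, the factor stays
    below some [q < 1] infinitely often, which forces the bound to tend to 0
    ([frequently_contracting_cvg0]). *)

(** * The Euclidean norm *)

Lemma enorm_ge0 {R : realType} {d : nat} (v : 'rV[R]_d) : 0 <= enorm v.
Proof. exact: sqrtr_ge0. Qed.

Lemma enorm0 {R : realType} {d : nat} : enorm (0 : 'rV[R]_d) = 0.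
Proof. by rewrite /enorm big1 ?sqrtr0 // => k _; rewrite mxE expr0n. Qed.

Lemma sqr_enorm {R : realType} {d : nat} (v : 'rV[R]_d) :
  enorm v ^+ 2 = \sum_(k < d) v ord0 k ^+ 2.
Proof. by rewrite sqr_sqrtr // sumr_ge0 // => k _; exact: sqr_ge0. Qed.

Lemma enormZ {R : realType} {d : nat} (a : R) (v : 'rV[R]_d) :
  enorm (a *: v) = `|a| * enorm v.
Proof.
rewrite /enorm -[in RHS]sqrtr_sqr -sqrtrM ?sqr_ge0 // mulr_sumr.
by congr Num.sqrt; apply: eq_bigr => k _; rewrite mxE exprMn.
Qed.

Lemma enormN {R : realType} {d : nat} (v : 'rV[R]_d) : enorm (- v) = enorm v.
Proof. by rewrite -scaleN1r enormZ normrN1 mul1r. Qed.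

Lemma cauchy_schwarz {R : realType} {d : nat} (u v : 'rV[R]_d) :
  \sum_(k < d) u ord0 k * v ord0 k <= enorm u * enorm v.
Proof.
have [uv0|uv0] := eqVneq (enorm u * enorm v) 0.
  rewrite uv0 big1 // => k _.
  have zero (w : 'rV[R]_d) : enorm w = 0 -> w ord0 k = 0.
    move=> w0; have /esym/eqP := sqr_enorm w.
    rewrite w0 expr0n psumr_eq0 => [|i _]; last exact: sqr_ge0.
    by move=> /allP/(_ k); rewrite mem_index_enum sqrf_eq0 => /(_ isT)/eqP.
  move/eqP: uv0; rewrite mulf_eq0.
  by case/orP => /eqP/zero ->; rewrite ?mul0r ?mulr0.
have uv_gt0 : 0 < enorm u * enorm v by rewrite lt_def uv0 mulr_ge0 ?enorm_ge0.
(* The square of the vector |v| u - |u| v, whose norm expands to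
   2 |u| |v| (|u| |v| - <u, v>). *)
have : 0 <= \sum_(k < d) (enorm v * u ord0 k - enorm u * v ord0 k) ^+ 2.
  by rewrite sumr_ge0 // => k _; exact: sqr_ge0.
rewrite (eq_bigr (fun k =>
  enorm v ^+ 2 * u ord0 k ^+ 2 + enorm u ^+ 2 * v ord0 k ^+ 2
  - (enorm u * enorm v *+ 2) * (u ord0 k * v ord0 k))); last first.
  by move=> k _; ring.
rewrite sumrB big_split /= -!mulr_sumr -!sqr_enorm.
rewrite (_ : _ - _ = (enorm u * enorm v *+ 2) *
  (enorm u * enorm v - \sum_(k < d) u ord0 k * v ord0 k)); last by ring.
by rewrite pmulr_rge0 ?subr_ge0 // pmulrn_lgt0.
Qed.

Lemma ler_enormD {R : realType} {d : nat} (u v : 'rV[R]_d) :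
  enorm (u + v) <= enorm u + enorm v.
Proof.
rewrite -(@ler_pXn2r _ 2) ?nnegrE ?addr_ge0 ?enorm_ge0 // sqrrD !sqr_enorm.
under eq_bigr do rewrite mxE sqrrD.
rewrite !big_split /= lerD2r lerD2l -mulr2n lerMn2r.
exact: cauchy_schwarz.
Qed.

Lemma ler_enormB {R : realType} {d : nat} (u v : 'rV[R]_d) :
  enorm (u - v) <= enorm u + enorm v.
Proof. by rewrite -(enormN v); exact: ler_enormD. Qed.

(** * Bounds on finite sums of opinions *)

Lemma ler_enorm_sum_fset {R : realType} {d : nat} (K : choiceType)
    (A : {fset K}) (F : K -> 'rV[R]_d) (b : R) :
  (forall k, k \in A -> enorm (F k) <= b) ->
  enorm (\sum_(k <- A) F k) <= #|` A|%:R * b.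
Proof.
move=> Fb; have -> : #|` A|%:R * b = \sum_(k <- A) b.
  by rewrite big_const_seq count_predT iter_addr_0 mulr_natl.
rewrite [leLHS](_ : _ = enorm (\sum_(k <- A | k \in A) F k)); last first.
  by rewrite -big_seq.
rewrite [leRHS]big_seq.
elim/big_ind2: _ => //; first by rewrite enorm0.
by move=> u a v c ua vc; rewrite (le_trans (ler_enormD _ _))// lerD.
Qed.

(** The terms indexed by the intersection cancel. The two differences have the
    same number [n] of elements, so centring the first sum at [u] and the second
    at [v] leaves the error [n (u - v)]: this accounts for the factor 3 without
    choosing a bijection between the differences. *)
Lemma ler_enorm_sum_symdiff {R : realType} {d : nat} (K : choiceType)
    (A B : {fset K}) (y : K -> 'rV[R]_d) (u v : 'rV[R]_d) (b : R) :
  #|` A| = #|` B| ->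
  (forall k, k \in A -> enorm (y k - u) <= b) ->
  (forall k, k \in B -> enorm (y k - v) <= b) ->
  enorm (u - v) <= b ->
  enorm (\sum_(k <- A) y k - \sum_(k <- B) y k) <=
    (3 * (#|` A| - #|` (A `&` B)%fset|))%:R * b.
Proof.
move=> AB Au Bv uv.
have splitI (X Y : {fset K}) :
    \sum_(k <- X) y k = \sum_(k <- (X `&` Y)%fset) y k + \sum_(k <- (X `\` Y)%fset) y k.
  rewrite (big_fsetID _ (mem Y)) /=.
  by congr (_ + _); apply: eq_fbigl => k; rewrite !inE //= andbC.
have cAB : #|` (A `\` B)%fset| = (#|` A| - #|` (A `&` B)%fset|)%N by rewrite cardfsD.
have cBA : #|` (B `\` A)%fset| = (#|` A| - #|` (A `&` B)%fset|)%N.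
  by rewrite cardfsD fsetIC AB.
have center (X : {fset K}) (c : 'rV[R]_d) :
    \sum_(k <- X) y k = \sum_(k <- X) (y k - c) + c *+ #|` X|.
  rewrite sumrB [X in _ - X]big_const_seq count_predT iter_addr_0.
  by rewrite subrK.
rewrite (splitI A B) (splitI B A) [(B `&` A)%fset]fsetIC.
rewrite opprD addrACA subrr add0r (center _ u) [X in _ - X](center _ v).
rewrite cAB cBA; set n := (_ - _)%N in cAB cBA *.
rewrite opprD addrACA -mulrnBl.
apply: (le_trans (ler_enormD _ _)).
rewrite -[_ *+ n]scaler_nat enormZ ger0_norm ?ler0n //.
rewrite natrM [leRHS](_ : _ = n%:R * b + n%:R * b + n%:R * b); last by ring.
apply: lerD; last by rewrite ler_wpM2l.
apply: (le_trans (ler_enormB _ _)).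
apply: lerD.
- by rewrite -cAB; apply: ler_enorm_sum_fset => k; rewrite inE => /andP[_ /Au].
- by rewrite -cBA; apply: ler_enorm_sum_fset => k; rewrite inE => /andP[_ /Bv].
Qed.

(** * One step of the dynamics *)

(** A real upper bound for the edge diameter; unlike the extended-real supremum,
    it can be propagated along the dynamics by ordinary arithmetic. *)
Definition edges_within {R : realType} {d : nat} (E : set (vertex * vertex))
    (y : vertex -> 'rV[R]_d) (b : R) : Prop :=
  forall i j, E (i, j) -> enorm (y i - y j) <= b.

Lemma profile_eqE {R : realType} {d : nat} (E : set (vertex * vertex))
    (eps : R) (y : vertex -> 'rV[R]_d) :
  simple_graph E -> profile E eps y = E <-> edges_within E y eps.
Proof.
move=> [Eirr _]; split=> [Ey i j|Ey].
  by rewrite -Ey => -[_ []].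
apply/seteqP; split=> [e []//|[i j] Eij]; split=> //; split=> /= [ij|].
- by apply: (Eirr i); move: Eij; rewrite -ij.
- exact: Ey.
Qed.

Lemma nbhd_finite (E : set (vertex * vertex)) (i : vertex) :
  locally_finite E -> finite_set (nbhd E i).
Proof.
by move=> Efin; rewrite finite_setU; split; [exact: finite_set1|exact: Efin].
Qed.

Lemma ncard_nbhd_regular (E : set (vertex * vertex)) (k : nat) (i : vertex) :
  simple_graph E -> locally_finite E -> regular_graph E k ->
  ncard (nbhd E i) = k.+1.
Proof.
move=> [Eirr _] Efin Ereg.
rewrite /ncard (_ : nbhd E i = i |` [set j | E (i, j)]) // fset_setU1 //.
rewrite cardfsU1 (card_fset_set (Ereg i)) in_fset_set //.
by rewrite memNset //; exact: Eirr.
Qed.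

Lemma contraction_factor_itv {R : realType} (a : R) (r : nat) :
  0 <= a <= 1 -> 0 <= 1 - (1 - a) / r.+1%:R <= 1.
Proof.
move=> /andP[a0 a1].
rewrite subr_ge0 ler_pdivrMr ?ltr0n // mul1r.
rewrite gerBl divr_ge0 ?subr_ge0 ?ler0n // andbT.
by rewrite (@le_trans _ _ 1) ?gerBl // ler1n.
Qed.

(** In a graph of degree [r] the averages have [r.+1] terms, of which fewer than
    a third lie outside the common neighbourhood; the difference of the two
    sums is therefore at most [r * b], and a [1 / r.+1] share of the moving
    part is gained. The hypothesis [b <= eps] guarantees that every social
    neighbour is actually listened to. *)
Lemma hk_update_edges_within {R : realType} {d : nat} (E : set (vertex * vertex))
    (r : nat) (eps a b : R) (y : vertex -> 'rV[R]_d) :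
  simple_graph E -> locally_finite E -> regular_graph E r ->
  (forall i j, E (i, j) ->
     (2 * r.+1 < 3 * ncard (nbhd E i `&` nbhd E j))%N) ->
  0 <= a <= 1 -> 0 <= b -> b <= eps -> edges_within E y b ->
  edges_within E (hk_update E eps (fun=> a) y)
    ((1 - (1 - a) / r.+1%:R) * b).
Proof.
move=> Esimple Efin Ereg Eov /andP[a0 a1] b0 beps Eb i j Eij.
have prof : profile E eps y = E.
  by apply/profile_eqE => // k l /Eb/le_trans; exact.
have cardN k : ncard (nbhd E k) = r.+1 by exact: ncard_nbhd_regular.
have near k l : l \in fset_set (nbhd E k) -> enorm (y l - y k) <= b.
  rewrite in_fset_set; last exact: nbhd_finite.
  rewrite inE => -[->|Ekl]; first by rewrite subrr enorm0.
  exact/Eb/Esimple.2.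
rewrite /hk_update prof !cardN !fsbig_finite; try exact: nbhd_finite.
set A := fset_set (nbhd E i); set B := fset_set (nbhd E j).
have := Eov _ _ Eij.
rewrite /ncard fset_setI; try exact: nbhd_finite.
rewrite -/A -/B => AB.
have cA : #|` A| = r.+1 by exact: cardN.
have cB : #|` B| = r.+1 by exact: cardN.
rewrite opprD addrACA -!scalerBr.
apply: (le_trans (ler_enormD _ _)).
have c0 : 0 <= (1 - a) / r.+1%:R by rewrite divr_ge0 ?subr_ge0 ?ler0n.
rewrite !enormZ (ger0_norm a0) (ger0_norm c0).
have diff_le : enorm (\sum_(k <- A) y k - \sum_(k <- B) y k) <= r%:R * b.
  apply: (le_trans (@ler_enorm_sum_symdiff _ _ _ A B y (y i) (y j) b _ _ _ _)).
  - by rewrite cA cB.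
  - exact: near.
  - exact: near.
  - exact: Eb.
  - (* Integrality turns [3 n < r.+1] into [3 n <= r]. *)
    by rewrite ler_wpM2r // ler_nat cA; lia.
rewrite [leRHS](_ : _ = a * b + (1 - a) / r.+1%:R * (r%:R * b)).
  by rewrite lerD // ler_wpM2l // Eb.
by rewrite -natr1; field; rewrite natr1 pnatr_eq0.
Qed.

(** * Convergence to zero *)

Lemma limn_einf_lt_frequently {R : realType} (u : (\bar R)^nat) (l : \bar R) :
  (limn_einf u < l)%E -> forall n, exists2 t, (n <= t)%N & (u t < l)%E.
Proof.
move=> ul n.
have : (einfs u n < l)%E.
  apply: le_lt_trans ul; rewrite limn_einf_lim.
  rewrite (cvg_lim _ (@cvg_einfs_sup _ u)) //.
  by apply: ereal_sup_ubound; exists n.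
by move=> /ereal_inf_lt[_ [t /= nt <-] ut]; exists t.
Qed.

(** The limit [l] exists by monotonicity. At a contracting time [t >= n],
    [l <= u t.+1 <= q * u t <= q * u n]; letting [n] grow gives [l <= q * l],
    so [l = 0]. *)
Lemma frequently_contracting_cvg0 {R : realType} (u : R^nat) (q : R) :
  0 <= q < 1 -> (forall t, 0 <= u t) -> (forall t, u t.+1 <= u t) ->
  (forall n, exists2 t, (n <= t)%N & u t.+1 <= q * u t) ->
  u t @[t --> \oo] --> 0.
Proof.
move=> /andP[q0 q1] u0 udec ufreq.
have uni : {homo u : n m / (n <= m)%N >-> m <= n} by exact/nonincreasing_seqP.
have ucvg : cvgn u.
  by apply: nonincreasing_is_cvgn => //; exists 0 => _ [t _ <-].
have lu := nonincreasing_cvgn_ge uni ucvg.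
have l0 : 0 <= limn u by apply: limr_ge => //; exact: nearW.
have lq : limn u <= q * limn u.
  have qcvg : q * u n @[n --> \oo] --> q * limn u by apply: cvgM => //; exact: cvg_cst.
  rewrite -[leRHS](cvg_lim _ qcvg) //.
  apply: limr_ge; first by apply/cvg_ex; exists (q * limn u).
  apply: nearW => n; have [t nt ut] := ufreq n.
  by rewrite (le_trans (lu t.+1)) // (le_trans ut) // ler_wpM2l // uni.
have -> : 0 = limn u by apply/eqP; rewrite eq_le l0 /=; nra.
exact: ucvg.
Qed.

Lemma edge_diameter_ge0 {R : realType} {d : nat} (E : set (vertex * vertex))
    (y : vertex -> 'rV[R]_d) : (0 <= edge_diameter E y)%E.
Proof. by apply: ereal_sup_ubound; left. Qed.

Lemma edge_diameter_le {R : realType} {d : nat} (E : set (vertex * vertex))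
    (y : vertex -> 'rV[R]_d) (b : R) :
  0 <= b -> edges_within E y b -> (edge_diameter E y <= b%:E)%E.
Proof.
move=> b0 Eb; apply: ge_ereal_sup => _ [->|[[i j] Eij <-]]; rewrite lee_fin //.
exact: Eb.
Qed.

Theorem theorem2 (R : realType) (d : nat)
  (disp : measure_display) (T : measurableType disp) (P : probability T R)
  (E : set (vertex * vertex)) (eps : R)
  (alpha : vertex -> nat -> {RV P >-> R}) (S : set (set vertex))
  (x : vertex -> nat -> T -> 'rV[R]_d)
  (r : nat) (alphac : nat -> T -> R)
  (E_simple : simple_graph E)
  (E_locfin : locally_finite E)
  (eps_gt0 : 0 < eps)
  (alpha_01 : forall i t w, 0 <= alpha i t w <= 1)
  (alpha_iid : forall i, iid P (@measurable _ R) (fun t w => alpha i t w))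
  (U_iid : iid P powerset_sigma (nonstubborn alpha))
  (U_support : forall t, random_set_support P (nonstubborn alpha t) = S)
  (S_cover : forall i, exists2 A, S A & A i)
  (x_dyn : forall i t w,
     x i t.+1 w =
       hk_update E eps (fun j => alpha j t w) (fun j => x j t w) i)
  (r_ge1 : (1 <= r)%N)
  (E_regular : regular_graph E (r - 1))
  (alpha_common : forall i t w, alpha i t w = alphac t w)
  (E_overlap : forall i j, E (i, j) ->
     (2 * r < 3 * ncard (nbhd E i `&` nbhd E j))%N) :
  forall w : T,
    (limn_einf (fun t => (alphac t w)%:E) < 1)%E ->
    (exists s, profile E eps (fun j => x j s w) = E) ->
    edge_diameter E (fun j => x j t w) @[t --> \oo] --> 0%E.
Proof.
move=> w a_liminf [s s_profile].
case: r => // r in r_ge1 E_regular E_overlap *; rewrite subn1 /= in E_regular.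
pose a t := alphac t w.
have a01 t : 0 <= a t <= 1.
  (* Any vertex gives access to the common stubbornness. *)
  by rewrite /a -(alpha_common (exist _ 1%N isT)); exact: alpha_01.
pose q t : R := 1 - (1 - a t) / r.+1%:R.
have r_gt0 : 0 < r.+1%:R :> R by rewrite ltr0n.
have q01 t : 0 <= q t <= 1 by exact/contraction_factor_itv/a01.
pose D t : R := eps * \prod_(k < t) q (k + s)%N.
have D0 : D 0%N = eps by rewrite /D big_ord0 mulr1.
have DS t : D t.+1 = q (t + s)%N * D t.
  by rewrite /D big_ord_recr /= mulrA mulrC.
have D_ge0 t : 0 <= D t.
  rewrite mulr_ge0 ?(ltW eps_gt0) // prodr_ge0 // => k _.
  by have /andP[] := q01 (k + s)%N.
have D_dec t : D t.+1 <= D t.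
  by rewrite DS ler_piMl //; have /andP[] := q01 (t + s)%N.
have D_le_eps t : D t <= eps.
  by elim: t => [|t]; [rewrite D0|apply: le_trans].
have D_bounds t : edges_within E (fun j => x j (t + s)%N w) (D t).
  elim: t => [|t IHt]; first by rewrite D0; exact/profile_eqE.
  rewrite DS addSn => i j Eij; rewrite !x_dyn.
  have -> : (fun j => alpha j (t + s)%N w : R) = fun=> a (t + s)%N.
    by apply/funext => k; rewrite alpha_common.
  exact: (@hk_update_edges_within _ _ E r eps _ _ (fun j => x j (t + s)%N w)).
have [c [c0 c1 a_lt_c]] : exists c, [/\ 0 <= c, c < 1 &
    forall n, exists2 t, (n <= t)%N & a t < c].
  have a_freq c : (limn_einf (fun t => (a t)%:E) < c%:E)%E ->
      forall n, exists2 t, (n <= t)%N & a t < c.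
    by move=> /limn_einf_lt_frequently ac n; have [t nt] := ac n; exists t.
  (* For a finite lower limit, its midpoint with 1; some [a t] below it shows
     that it is nonnegative. *)
  case L: (limn_einf _) a_liminf => [l| |] // l1.
  - have l_lt1 : l < 1 by [].
    have lc : forall n, exists2 t, (n <= t)%N & a t < (l + 1) / 2.
      by apply: a_freq; rewrite L lte_fin; lra.
    exists ((l + 1) / 2); split => //; last by lra.
    have [t _ /ltW] := lc 0%N; apply: le_trans.
    by have /andP[] := a01 t.
  - exists 0; split => //; apply: a_freq; rewrite L; exact: ltNyr.
have D_cvg0 : D t @[t --> \oo] --> 0.
  apply: (@frequently_contracting_cvg0 _ D (1 - (1 - c) / r.+1%:R)) => //.
    apply/andP; split; last by rewrite gtrBl divr_gt0 // subr_gt0.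
    have c01 : 0 <= c <= 1 by rewrite c0 ltW.
    by have /andP[] := contraction_factor_itv c r c01.
  (* The contracting times [t >= n + s] become indices [t - s >= n] of [D]. *)
  move=> n; have [t nt atc] := a_lt_c (n + s)%N.
  exists (t - s)%N; first lia.
  rewrite DS subnK; last lia.
  rewrite ler_wpM2r // /q lerD2l lerN2 ler_pM2r ?invr_gt0 //.
  by rewrite lerD2l lerN2 ltW.
rewrite -(cvg_shiftn s).
apply: (@squeeze_cvge _ _ _ R (fun=> 0%E)
  (fun t => edge_diameter E (fun j => x j (t + s)%N w))
  (fun t => (D t)%:E) _ 0%E).
- apply: nearW => t; rewrite edge_diameter_ge0 /=.
  exact/edge_diameter_le/D_bounds.
- exact: cvg_cst.
- by apply: cvg_EFin => //; exact: nearW.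
Qed.
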